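(* Let $N\ge 2$ be an integer. For $z>0$, define $\boldsymbol{\varphi}_z=(\varphi_{n,z})_{1\le n \le N}\in \mathcal{D}_{1,N}$ by $$\nu_N(z) := \sum_{n=1}^N \frac{2z}{1+n^2 z^2}, \qquad \varphi_{n,z} := \frac{1}{\nu_N(z)} \frac{2z}{1 + n^2 z^2}, \quad 1\le n \le N.$$ Then $$\frac{1}{\mu_N} = \bar{\nu}_N := \max_{[1/N,1]} \nu_N = \max_{(1/N,1)} \nu_N ,$$ and $\mathbf{a}\in\mathcal{D}_{1,N}$ satisfies $S_N[\mathbf{a}]=\mu_N$ if and only if there is $Z\in (1/N,1)$ such that $\nu_N(Z) = \bar{\nu}_N$ and $\mathbf{a}=\boldsymbol{\varphi}_{Z}$. Moreover, letting $Z_2>0$ be given by $$Z_2^2 := \frac{1}{60} \left( 1 + \left(11251 - 90 \sqrt{12261}\right)^{1/3} + \left(11251 + 90 \sqrt{12261}\right)^{1/3}\right),$$ there holds $$\mu_N \ge \frac{1}{2 \arctan(NZ_2)} > \frac{1}{2 \arctan N}.$$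
   Context: For an integer $N\ge 2$, let $$\mathcal{D}_{1,N} := \left\{ \mathbf{a}=(a_n)_{1\le n\le N}\in [0,\infty)^N\ :\ \sum_{n=1}^N a_n =1 \right\},$$ $$S_N[\mathbf{a}] := \left( \sum_{n=1}^N a_n^2 \right)^{1/2} \left( \sum_{n=1}^N n^2 a_n^2 \right)^{1/2}, \quad \mathbf{a}\in \mathcal{D}_{1,N}, \qquad \mu_N := \inf_{\mathbf{a}\in\mathcal{D}_{1,N}} S_N[\mathbf{a}].$$ *)

(* Defs.v *)
From mathcomp Require Import all_boot all_order all_algebra.
From mathcomp Require Import all_classical all_reals all_analysis.

Set Implicit Arguments.
Unset Strict Implicit.
Unset Printing Implicit Defensive.

Import Order.TTheory GRing.Theory Num.Theory.

Local Open Scope classical_set_scope.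
Local Open Scope ring_scope.

(* Sequences (a_n) with 1 <= n <= N are finite functions on 'I_N: the index
   n is the successor i.+1 of the ordinal i. *)

Definition D1N (R : realType) (N : nat) : set {ffun 'I_N -> R} :=
  [set a | (forall i, 0 <= a i) /\ \sum_(i < N) a i = 1].

Definition SN (R : realType) (N : nat) (a : {ffun 'I_N -> R}) : R :=
  Num.sqrt (\sum_(i < N) a i ^+ 2) *
  Num.sqrt (\sum_(i < N) i.+1%:R ^+ 2 * a i ^+ 2).

(* [inf] is the infimum of a real set only if the set is nonempty and bounded
   below. This holds here for N > 0, as SN is nonnegative. *)
Definition muN (R : realType) (N : nat) : R := inf (@SN R N @` @D1N R N).

Definition nuN (R : realType) (N : nat) (z : R) : R :=
  \sum_(i < N) (2 * z) / (1 + i.+1%:R ^+ 2 * z ^+ 2).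

Definition phi (R : realType) (N : nat) (z : R) : {ffun 'I_N -> R} :=
  [ffun i : 'I_N => (nuN N z)^-1 * ((2 * z) / (1 + i.+1%:R ^+ 2 * z ^+ 2))].

(* m is the maximum of f on A, and it is attained. *)
Definition is_max (R : realType) (A : set R) (f : R -> R) (m : R) : Prop :=
  (f @` A) m /\ ubound (f @` A) m.

(* Both cube roots are taken of positive numbers, so that the real power
   [powR] is the usual cube root. *)
Definition Z2sq (R : realType) : R :=
  60^-1 * (1 + (11251 - 90 * Num.sqrt 12261) `^ (3^-1)
             + (11251 + 90 * Num.sqrt 12261) `^ (3^-1)).

(* Main.v *)
(** For [0 < z], Cauchy-Schwarz with the weights [2 z / (1 + n^2 z^2)] followed by
    the choice [z = (sum a_n^2 / sum n^2 a_n^2)^(1/2)], which lies in [1/N, 1],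
    gives [SN a >= 1 / nuN z], with equality only for [a = phi z]. In the other
    direction AM-GM gives [SN (phi z) <= 1 / nuN z] for every [z]. Hence
    [1 / muN] is the maximum of [nuN]; at a maximizer [Z] the two inequalities
    are equalities, so [Z^2] is the ratio [sum a_n^2 / sum n^2 a_n^2] for
    [a = phi Z], and since all entries of [phi Z] are positive this ratio lies
    strictly between [1/N^2] and [1].

    For the lower bound on [muN], [nuN z <= 2 atan (N z)] by comparing the sum
    with an integral. By Cardano's formula, [Z2^2] is the real root of
    [20 s^3 = s^2 + 5 s + 2], so [Z2] is the critical point of [nuN] for [N = 2];
    beyond it the first two terms decrease together and each later term
    decreases, so [nuN] is largest at some [z <= Z2]. *)
Require Import Defs.
From mathcomp Require Import all_boot all_order all_algebra.
From mathcomp Require Import all_classical all_reals all_analysis.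
From mathcomp Require Import ring lra.

Set Implicit Arguments.
Unset Strict Implicit.
Unset Printing Implicit Defensive.

Import Order.TTheory GRing.Theory Num.Theory.
Import numFieldNormedType.Exports.

Local Open Scope classical_set_scope.
Local Open Scope ring_scope.

(** * Sharp bounds on [SN] by [nuN], for a fixed length *)

Section FixedLength.
Variables (R : realType) (N : nat).
Implicit Types (a : {ffun 'I_N -> R}) (z : R).

Definition weight z (i : 'I_N) : R :=
  (2 * z) / (1 + i.+1%:R ^+ 2 * z ^+ 2).

Definition sqsum a : R := \sum_(i < N) a i ^+ 2.
Definition wsqsum a : R := \sum_(i < N) i.+1%:R ^+ 2 * a i ^+ 2.

Lemma one_plus_sqr_gt0 (x z : R) : 0 < 1 + x ^+ 2 * z ^+ 2.
Proof. by rewrite ltr_pwDl// mulr_ge0// sqr_ge0. Qed.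

Lemma weight_gt0 z i : 0 < z -> 0 < weight z i.
Proof. by move=> z0; rewrite divr_gt0 ?one_plus_sqr_gt0// mulr_gt0. Qed.

Lemma nuN_gt0 z : (0 < N)%N -> 0 < z -> 0 < nuN N z.
Proof.
move=> N0 z0; rewrite /nuN (bigD1 (Ordinal N0))//= ltr_pwDl//.
  exact: (weight_gt0 (Ordinal N0)).
by rewrite sumr_ge0// => i _; exact/ltW/weight_gt0.
Qed.

Lemma phi_gt0 z i : (0 < N)%N -> 0 < z -> 0 < phi N z i.
Proof.
move=> N0 z0; rewrite ffunE mulr_gt0 ?invr_gt0 ?nuN_gt0//.
exact: weight_gt0.
Qed.

Lemma D1N_phi z : (0 < N)%N -> 0 < z -> D1N (phi N z).
Proof.
move=> N0 z0; split; first by move=> i; exact/ltW/phi_gt0.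
under eq_bigr do rewrite ffunE.
by rewrite -mulr_sumr mulVf// gt_eqF// nuN_gt0.
Qed.

Lemma sqsum_gt0 a : D1N a -> 0 < sqsum a.
Proof.
move=> [a0 a1]; rewrite lt_neqAle sumr_ge0 ?andbT; last first.
  by move=> i _; exact: sqr_ge0.
apply/eqP => A0; have := a1; rewrite big1.
  by move/eqP; rewrite eq_sym oner_eq0.
move=> i _; apply/eqP; rewrite -sqrf_eq0.
by have /psumr_eq0P -> := esym A0 => // j _; exact: sqr_ge0.
Qed.

Lemma sqsum_le_wsqsum a : sqsum a <= wsqsum a.
Proof.
apply: ler_sum => i _; rewrite ler_peMl ?sqr_ge0// expr_ge1//.
by rewrite ler1n.
Qed.

Lemma wsqsum_le_sqsum a : wsqsum a <= N%:R ^+ 2 * sqsum a.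
Proof.
rewrite /sqsum mulr_sumr; apply: ler_sum => i _; rewrite ler_wpM2r ?sqr_ge0//.
by rewrite ler_sqr ?nnegrE// ler_nat.
Qed.

(* Both sides equal [(sqsum a + z ^+ 2 * wsqsum a) / (2 * z)]: the square on the
   left is the defect in AM-GM, the sum on the right the one in Cauchy-Schwarz. *)
Lemma SN_defect a z : (0 < N)%N -> 0 < z -> D1N a ->
  SN a + (Num.sqrt (sqsum a) - z * Num.sqrt (wsqsum a)) ^+ 2 / (2 * z) =
  (nuN N z)^-1 + \sum_(i < N) (a i - phi N z i) ^+ 2 / weight z i.
Proof.
move=> N0 z0 [a0 a1].
have nu0 : nuN N z != 0 by rewrite gt_eqF// nuN_gt0.
have A0 : Num.sqrt (sqsum a) ^+ 2 = sqsum a.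
  by rewrite sqr_sqrtr// sumr_ge0// => i _; rewrite sqr_ge0.
have B0 : Num.sqrt (wsqsum a) ^+ 2 = wsqsum a.
  by rewrite sqr_sqrtr// sumr_ge0// => i _; rewrite mulr_ge0 ?sqr_ge0.
have zn0 : z != 0 by rewrite gt_eqF.
have -> : SN a + (Num.sqrt (sqsum a) - z * Num.sqrt (wsqsum a)) ^+ 2 / (2 * z) =
    (sqsum a + z ^+ 2 * wsqsum a) / (2 * z).
  by rewrite /SN -/(sqsum a) -/(wsqsum a) -[in RHS]A0 -[in RHS]B0; field.
(* Since [phi N z i] is [weight z i / nuN N z], each square expands with [1 / weight z i] equal to
   [(1 + n^2 z^2) / (2 z)]. *)
rewrite [X in _ = _ + X](eq_bigr (fun i =>
    (a i ^+ 2 + z ^+ 2 * (i.+1%:R ^+ 2 * a i ^+ 2)) / (2 * z)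
     - 2 / nuN N z * a i + (nuN N z)^-1 ^+ 2 * weight z i)); last first.
  move=> i _; rewrite ffunE /weight; field.
  by rewrite nu0 zn0 !andbT exprMn nat1r gt_eqF// one_plus_sqr_gt0.
have sw : \sum_(i < N) (nuN N z)^-1 ^+ 2 * weight z i = (nuN N z)^-1 ^+ 2 * nuN N z.
  by rewrite mulr_sumr.
rewrite big_split /= sw sumrB -mulr_suml big_split /= -!mulr_sumr a1.
by rewrite -/(sqsum a) -/(wsqsum a); field; rewrite nu0 zn0.
Qed.

Lemma SN_phi_le z : (0 < N)%N -> 0 < z -> SN (phi N z) <= (nuN N z)^-1.
Proof.
move=> N0 z0; have := SN_defect N0 z0 (D1N_phi N0 z0).
rewrite [X in _ = _ + X]big1 ?addr0; last by move=> i _; rewrite subrr expr0n mul0r.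
by move=> <-; rewrite lerDl divr_ge0 ?sqr_ge0// mulr_ge0// ltW.
Qed.

(** For [a = phi N z] the Cauchy-Schwarz defect is zero, so equality forces the AM-GM defect to
    vanish too. *)
Lemma SN_phi_eq z : (0 < N)%N -> 0 < z -> SN (phi N z) = (nuN N z)^-1 ->
  sqsum (phi N z) = z ^+ 2 * wsqsum (phi N z).
Proof.
move=> N0 z0 E; have := SN_defect N0 z0 (D1N_phi N0 z0).
rewrite [X in _ = _ + X]big1 ?addr0; last by move=> i _; rewrite subrr expr0n mul0r.
rewrite E => /eqP; rewrite -subr_eq0 addrAC subrr add0r mulf_eq0 invr_eq0.
rewrite [X in _ || X]gt_eqF ?mulr_gt0// orbF sqrf_eq0 subr_eq0.
move=> /eqP /(congr1 (fun x => x ^+ 2)).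
rewrite /= exprMn !sqr_sqrtr//; last 2 first.
  by apply: sumr_ge0 => i _; rewrite mulr_ge0 ?sqr_ge0.
by apply: sumr_ge0 => i _; rewrite sqr_ge0.
Qed.

Lemma SN_phi_interior z : (2 <= N)%N -> 0 < z ->
  SN (phi N z) = (nuN N z)^-1 -> N%:R^-1 < z < 1.
Proof.
move=> N2 z0 E; have N0 : (0 < N)%N := ltnW N2.
have AB := SN_phi_eq N0 z0 E.
have N1 : (N.-1 < N)%N by rewrite prednK.
have sqr0 i : 0 < phi N z i ^+ 2 by rewrite exprn_gt0// phi_gt0.
(* The last index makes this strict, as [1 < N^2]; below, the first index does the same for the
   upper bound. *)
have AltB : sqsum (phi N z) < wsqsum (phi N z).
  rewrite -subr_gt0 -sumrB (bigD1 (Ordinal N1))//= ltr_pwDl//.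
    rewrite subr_gt0 ltr_pMl// prednK// expr_gt1// ?ltr1n//.
  rewrite sumr_ge0// => i _; rewrite subr_ge0 ler_peMl ?sqr_ge0//.
  by rewrite expr_ge1// ler1n.
have BltA : wsqsum (phi N z) < N%:R ^+ 2 * sqsum (phi N z).
  rewrite /sqsum mulr_sumr -subr_gt0 -sumrB (bigD1 (Ordinal N0))//= ltr_pwDl//.
    by rewrite subr_gt0 ltr_pM2r// expr1n expr_gt1// ?ltr1n//.
  rewrite sumr_ge0// => i _; rewrite subr_ge0 ler_wpM2r ?sqr_ge0//.
  by rewrite ler_sqr ?nnegrE// ler_nat.
have B0 : 0 < wsqsum (phi N z).
  by rewrite (lt_trans _ AltB)// sqsum_gt0//; exact: D1N_phi.
have NR0 : 0 < N%:R :> R by rewrite ltr0n.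
apply/andP; split.
  rewrite -(ltr_pM2l NR0) divff ?gt_eqF// -(@expr_gt1 _ 2)//; last first.
    by rewrite mulr_ge0// ltW.
  by rewrite exprMn -(ltr_pM2r B0) mul1r -mulrA -AB.
by rewrite -(@expr_lt1 _ 2)// ?ltW// -(ltr_pM2r B0) mul1r -AB.
Qed.

(** A bound on [[1/N, 1]] suffices because the optimal [z] for any [a] lies there. *)
Lemma le_nuN_max (M : R) : (0 < N)%N ->
  (forall z, N%:R^-1 <= z <= 1 -> nuN N z <= M) ->
  forall a, D1N a -> M^-1 <= SN a /\
    (SN a = M^-1 -> exists z, [/\ 0 < z, nuN N z = M & a = phi N z]).
Proof.
move=> N0 leM a Da.
have A0 := sqsum_gt0 Da.
have AB := sqsum_le_wsqsum a; have BA := wsqsum_le_sqsum a.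
have B0 := lt_le_trans A0 AB.
have sA0 : 0 < Num.sqrt (sqsum a) by rewrite sqrtr_gt0.
have sB0 : 0 < Num.sqrt (wsqsum a) by rewrite sqrtr_gt0.
have NR0 : 0 < N%:R :> R by rewrite ltr0n.
(* This [z] kills the AM-GM defect in [SN_defect]. *)
pose z := Num.sqrt (sqsum a) / Num.sqrt (wsqsum a).
have z0 : 0 < z by rewrite divr_gt0.
have zI : N%:R^-1 <= z <= 1.
  apply/andP; split; last by rewrite /z ler_pdivrMr// mul1r ler_sqrt// ltW.
  rewrite /z ler_pdivlMr// ler_pdivrMl//.
  rewrite -[X in X * _](ger0_norm (ltW NR0)) -sqrtr_sqr -sqrtrM ?sqr_ge0//.
  exact: ler_wsqrtr.
have := SN_defect N0 z0 Da.
rewrite [X in _ - X]divfK ?gt_eqF// subrr expr0n mul0r addr0 => ->.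
have nu0 := nuN_gt0 N0 z0.
have nuM := leM _ zI.
have M0 := lt_le_trans nu0 nuM.
have Mnu : M^-1 <= (nuN N z)^-1 by rewrite lef_pV2.
have T0 i : true -> 0 <= (a i - phi N z i) ^+ 2 / weight z i.
  by move=> _; rewrite divr_ge0 ?sqr_ge0// ltW// weight_gt0.
have S0 := sumr_ge0 (index_enum _) T0.
split; first by rewrite -[leLHS]addr0 lerD.
move=> E; exists z; split=> //.
  by apply/invr_inj/eqP; rewrite eq_le Mnu andbT -E lerDl.
have SE : \sum_(i < N) (a i - phi N z i) ^+ 2 / weight z i = 0.
  by apply/eqP; rewrite eq_le S0 andbT; lra.
apply/ffunP => i; apply/eqP; rewrite -subr_eq0 -sqrf_eq0.
have /eqP : (a i - phi N z i) ^+ 2 / weight z i = 0 by exact: (psumr_eq0P T0 SE).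
by rewrite mulf_eq0 invr_eq0 [X in _ || X]gt_eqF ?weight_gt0// orbF.
Qed.

End FixedLength.

(** * Continuity of [nuN], the arctangent bound and decrease beyond [Z2] *)

Section VaryingLength.
Variable R : realType.

Lemma continuous_nuN (N : nat) : continuous (@nuN R N).
Proof.
move=> z; apply: cvg_big; first exact: add_continuous.
move=> i _.
apply: cvgM; first by apply: cvgM; [exact: cvg_cst | exact: cvg_id].
apply: cvgV; first by rewrite gt_eqF// one_plus_sqr_gt0.
apply: cvgD; first exact: cvg_cst.
by apply: cvgM; [exact: cvg_cst | exact: exprn_continuous].
Qed.

(** Mean value theorem: the derivative of [atan] is smallest at the right end [y]. *)
Lemma atan_sub_ge (x y : R) : 0 <= x -> x <= y ->
  (y - x) / (1 + y ^+ 2) <= atan y - atan x.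
Proof.
move=> x0 xy.
have [c /itvP cI ->] := @MVT_segment R atan (fun x => (1 + x ^+ 2)^-1) x y xy
  (fun x _ => is_derive1_atan x)
  (continuous_subspaceT (fun x => @continuous_atan R x)).
have pos (t : R) : 0 < 1 + t ^+ 2 by rewrite ltr_pwDl// sqr_ge0.
rewrite mulrC ler_wpM2r ?subr_ge0// lef_pV2 ?posrE// lerD2l.
have c0 : 0 <= c by rewrite (le_trans x0)// cI.
by rewrite ler_sqr ?nnegrE ?cI// (le_trans c0)// cI.
Qed.

(** Term [n] is at most twice the increment of [atan] from [(n-1) z] to [n z]; the increments
    telescope. *)
Lemma nuN_le_atan (N : nat) (z : R) : 0 <= z -> nuN N z <= 2 * atan (N%:R * z).
Proof.
move=> z0; elim: N => [|N IH].
  by rewrite /nuN big_ord0 mul0r atan0 mulr0.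
rewrite /nuN big_ord_recr /= -/(nuN N z).
have := @atan_sub_ge (N%:R * z) (N.+1%:R * z) (mulr_ge0 (ler0n _ _) z0).
rewrite ler_wpM2r ?ler_nat// => /(_ isT).
rewrite -mulrBl -natrB// subSnn mul1r exprMn -mulrA.
by move: IH; lra.
Qed.

Lemma weight_decreasing (n : nat) (x z : R) : 0 < x -> x <= z ->
  1 <= n%:R ^+ 2 * (x * z) ->
  2 * z / (1 + n%:R ^+ 2 * z ^+ 2) <= 2 * x / (1 + n%:R ^+ 2 * x ^+ 2).
Proof.
move=> x0 xz h.
rewrite ler_pdivrMr ?one_plus_sqr_gt0// mulrAC ler_pdivlMr ?one_plus_sqr_gt0//.
rewrite -subr_ge0.
have -> : 2 * x * (1 + n%:R ^+ 2 * z ^+ 2) - 2 * z * (1 + n%:R ^+ 2 * x ^+ 2)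
  = 2 * ((z - x) * (n%:R ^+ 2 * (x * z) - 1)) by ring.
by rewrite mulr_ge0// mulr_ge0// subr_ge0.
Qed.

(** The lower bound fixes signs in the monotonicity arguments, notably that of [8 * p - 5]; the
    upper one yields [Z2 < 1]. *)
Lemma critical_root_bounds (s : R) : 20 * s ^+ 3 = s ^+ 2 + 5 * s + 2 ->
  0 < s -> 5 / 8 < s < 1.
Proof.
move=> h s0; apply/andP; split; rewrite ltNge; apply/negP => h'; nra.
Qed.

(* The hypothesis on [x] says that [x] is a critical point of [nuN 2]. *)
Lemma two_weights_decreasing (x z : R) : 0 < x -> x <= z ->
  20 * (x ^+ 2) ^+ 3 = (x ^+ 2) ^+ 2 + 5 * x ^+ 2 + 2 ->
  2 * z / (1 + z ^+ 2) + 2 * z / (1 + 4 * z ^+ 2) <=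
  2 * x / (1 + x ^+ 2) + 2 * x / (1 + 4 * x ^+ 2).
Proof.
move=> x0 xz h.
have /andP[s1 s2] := critical_root_bounds h (exprn_gt0 2 x0).
have p1 (t : R) : 0 < 1 + t ^+ 2 by rewrite ltr_pwDl// sqr_ge0.
have p4 (t : R) : 0 < 1 + 4 * t ^+ 2 by rewrite ltr_pwDl// mulr_ge0// sqr_ge0.
have q : x ^+ 2 <= x * z by rewrite expr2 ler_pM2l.
rewrite -subr_ge0.
pose p := x * z; pose u := (z - x) ^+ 2.
(* After the factor [z - x], the numerator is symmetric in [x] and [z], hence a polynomial in [p]
   and [u] through [x^2 + z^2 = 2 p + u]. At [u = 0] it is the critical-point cubic in [p]. *)
have -> : 2 * x / (1 + x ^+ 2) + 2 * x / (1 + 4 * x ^+ 2) -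
   (2 * z / (1 + z ^+ 2) + 2 * z / (1 + 4 * z ^+ 2)) =
   2 * (z - x) * (20 * p ^+ 3 - p ^+ 2 - 5 * p - 2 + (8 * p - 5) * u)
   / ((1 + x ^+ 2) * (1 + 4 * x ^+ 2) * ((1 + z ^+ 2) * (1 + 4 * z ^+ 2))).
  by rewrite /p /u; field; rewrite !gt_eqF.
rewrite divr_ge0//; last by rewrite ltW// !mulr_gt0.
rewrite mulr_ge0//; first by rewrite mulr_ge0// subr_ge0.
rewrite addr_ge0//; last by rewrite mulr_ge0 ?sqr_ge0//; rewrite /p; lra.
rewrite -/p in q.
move: h s1 s2 q; move: (x ^+ 2) p => s p h s1 s2 q.
(* The cubic vanishes at [s], so [p - s] splits off. *)
have -> : 20 * p ^+ 3 - p ^+ 2 - 5 * p - 2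
  = (p - s) * (20 * (p ^+ 2 + p * s + s ^+ 2) - p - s - 5)
    + (20 * s ^+ 3 - (s ^+ 2 + 5 * s + 2)) by ring.
rewrite h subrr addr0 mulr_ge0 ?subr_ge0//; nra.
Qed.

Lemma nuN_decreasing (N : nat) (x z : R) : (2 <= N)%N -> 0 < x -> x <= z ->
  20 * (x ^+ 2) ^+ 3 = (x ^+ 2) ^+ 2 + 5 * x ^+ 2 + 2 ->
  nuN N z <= nuN N x.
Proof.
case: N => [//|[//|N]] _ x0 xz h; rewrite /nuN !big_ord_recl !addrA lerD//.
  by have := two_weights_decreasing x0 xz h; rewrite /= expr1n !mul1r -natrX.
apply: ler_sum => i _; apply: weight_decreasing => //.
have /andP[s1 _] := critical_root_bounds h (exprn_gt0 2 x0).
have q : x ^+ 2 <= x * z by rewrite expr2 ler_pM2l.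
(* The remaining terms have [n >= 3], so [n^2 x z >= 9 * 5/8 > 1]. *)
have n3 : 9 <= (lift ord0 (lift ord0 i)).+1%:R ^+ 2 :> R.
  by rewrite -natrX ler_nat; apply: (@leq_exp2r 3 _ 2).
by nra.
Qed.

Lemma Z2sq_root : 0 < Z2sq R /\
  20 * Z2sq R ^+ 3 = Z2sq R ^+ 2 + 5 * Z2sq R + 2.
Proof.
rewrite /Z2sq; set r := Num.sqrt _.
have r0 : 0 <= r by exact: sqrtr_ge0.
have r2 : r ^+ 2 = 12261 by apply: sqr_sqrtr; exact: ler0n.
have m0 : 0 < 11251 - 90 * r by nra.
have p0 : 0 < 11251 + 90 * r by lra.
have cube (t : R) : 0 <= t -> (t `^ 3^-1) ^+ 3 = t.
  by move=> t0; rewrite -powR_mulrn ?powR_ge0// -powRrM mulVf// powRr1.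
(* Cardano's relation: [11251^2 - 8100 * 12261 = 301^3]. *)
have uv : (11251 - 90 * r) `^ 3^-1 * (11251 + 90 * r) `^ 3^-1 = 301 :> R.
  rewrite -powRM ?ltW//.
  have -> : (11251 - 90 * r) * (11251 + 90 * r) = 301 ^+ 3.
    by rewrite -subr_sqr exprMn r2; ring.
  by rewrite -powR_mulrn ?ler0n// -powRrM divff ?pnatr_eq0// powRr1 ?ler0n.
have := cube _ (ltW m0); have := cube _ (ltW p0); move: uv.
have := powR_gt0 3^-1 m0; have := powR_gt0 3^-1 p0.
move: (_ `^ _) (_ `^ _) => u v v0 u0 uv v3 u3; split.
  by rewrite mulr_gt0// !addr_gt0.
apply/eqP; rewrite -subr_eq0; apply/eqP.
have -> : 20 * (60^-1 * (1 + u + v)) ^+ 3 -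
  ((60^-1 * (1 + u + v)) ^+ 2 + 5 * (60^-1 * (1 + u + v)) + 2)
 = (u ^+ 3 + v ^+ 3 - 22502 + 3 * (u * v - 301) * (u + v)) / 10800 by field.
by rewrite uv v3 u3; ring.
Qed.

End VaryingLength.

Theorem theorem1p4 (R : realType) (N : nat) (hN : (2 <= N)%N) :
  (forall z : R, 0 < z -> D1N (phi N z)) /\
  (exists nubar : R,
    [/\ is_max `[N%:R^-1, 1] (@nuN R N) nubar,
        is_max `]N%:R^-1, 1[ (@nuN R N) nubar,
        1 / muN R N = nubar &
        forall a : {ffun 'I_N -> R}, D1N a ->
          (SN a = muN R N <->
           exists Z : R, [/\ N%:R^-1 < Z < 1, nuN N Z = nubar & a = phi N Z])]) /\
  (exists Z2 : R,
    [/\ 0 < Z2, Z2 ^+ 2 = Z2sq R,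
        1 / (2 * atan (N%:R * Z2)) <= muN R N &
        1 / (2 * atan N%:R) < 1 / (2 * atan (N%:R * Z2))]).
Proof.
have N0 : (0 < N)%N := ltnW hN.
have NR0 : 0 < N%:R :> R by rewrite ltr0n.
have NV0 : 0 < N%:R^-1 :> R by rewrite invr_gt0.
have N1 : N%:R^-1 <= 1 :> R by rewrite invf_le1// ler1n.
split; first by move=> z; exact: D1N_phi.
have [Z ZI Zmax] := EVT_max N1 (continuous_subspaceT (@continuous_nuN R N)).
have Z0 : 0 < Z by rewrite (lt_le_trans NV0)// (itvP ZI).
have bound a := le_nuN_max N0 (fun z (zI : N%:R^-1 <= z <= 1) => Zmax z zI) (a := a).
have SNphi z : 0 < z -> nuN N z = nuN N Z -> SN (phi N z) = (nuN N Z)^-1.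
  move=> z0 E; apply/eqP; rewrite eq_le (bound _ (D1N_phi N0 z0)).1 -E.
  by rewrite SN_phi_le.
have muE : muN R N = (nuN N Z)^-1.
  have lbS : lbound (@SN R N @` @D1N R N) (nuN N Z)^-1.
    by move=> _ [a Da <-]; exact: (bound a Da).1.
  have SZ : (@SN R N @` @D1N R N) (nuN N Z)^-1.
    by exists (phi N Z); [exact: D1N_phi | exact: SNphi].
  apply/eqP; rewrite eq_le; apply/andP; split.
    by apply: ge_inf => //; exists (nuN N Z)^-1.
  by apply: lb_le_inf => //; exists (nuN N Z)^-1.
(* This puts every maximizer in the open interval, so both maxima agree. *)
have interior z : 0 < z -> nuN N z = nuN N Z -> N%:R^-1 < z < 1.
  by move=> z0 E; apply: SN_phi_interior => //; rewrite SNphi// E.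
have nu0 := nuN_gt0 N0 Z0.
split.
  exists (nuN N Z); split.
  - by split=> [|_ [z zI <-]]; [exists Z | exact: Zmax].
  - split; first by exists Z => //=; rewrite in_itv/= interior.
    move=> _ [z zI <-]; apply: Zmax.
    exact: subset_itv_oo_cc.
  - by rewrite muE div1r invrK.
  - move=> a Da; rewrite muE; split.
      move=> /(bound a Da).2[z [z0 E ->]]; exists z; split=> //.
      exact: interior.
    by move=> [z [/andP[z0 _] E ->]]; apply: SNphi => //; exact: lt_trans z0.
have [s0 sE] := Z2sq_root R.
have Z2E : Num.sqrt (Z2sq R) ^+ 2 = Z2sq R by rewrite sqr_sqrtr// ltW.
have Z20 : 0 < Num.sqrt (Z2sq R) by rewrite sqrtr_gt0.
exists (Num.sqrt (Z2sq R)); move: Z2E Z20; set Z2 := Num.sqrt _ => Z2E Z20.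
have Z21 : Z2 < 1.
  by rewrite -(@expr_lt1 _ 2) ?ltW// Z2E; case/andP: (critical_root_bounds sE s0).
have atan_gt0 (x : R) : 0 < x -> 0 < 2 * atan x.
  by move=> x0; rewrite mulr_gt0// -(atan0 R) lt_atan.
have NZ2 : 0 < N%:R * Z2 by rewrite mulr_gt0.
split=> //.
  rewrite muE div1r lef_pV2 ?posrE ?atan_gt0//.
  (* If [Z <= Z2], monotonicity of [atan] suffices; otherwise [nuN N Z <= nuN N Z2] comes first. *)
  have [ZZ2|/ltW Z2Z] := leP Z Z2.
    apply: (le_trans (nuN_le_atan N (ltW Z0))).
    by rewrite ler_pM2l// le_atan// ler_pM2l.
  apply: le_trans (nuN_le_atan N (ltW Z20)).
  by apply: nuN_decreasing => //; rewrite Z2E.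
rewrite !div1r ltf_pV2 ?posrE ?atan_gt0// ltr_pM2l// lt_atan//.
by rewrite -[ltRHS]mulr1 ltr_pM2l.
Qed.
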